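(* For every $n\ge 4$, the cycle $C_n$ on $n$ vertices satisfies $rc^\ell(C_n)=src^\ell(C_n)=\lceil n/2\rceil$.
   Context: An edge-coloured path is rainbow if all its edges have distinct colours; a geodesic is a shortest path between its endpoints. An (not necessarily proper) edge-colouring of a connected graph is rainbow connected (resp. strongly rainbow connected) if any two vertices are joined by a rainbow path (resp. rainbow geodesic). An $r$-edge-list assignment of $G$ assigns to each edge $e$ a set $L(e)\subset\mathbb N$ with $|L(e)|\ge r$; an $L$-edge-colouring is an edge-colouring $c$ with $c(e)\in L(e)$ for all $e$. $rc^\ell(G)$ (resp. $src^\ell(G)$) is the minimum integer $r$ such that for every $r$-edge-list assignment $L$ of $G$ there exists a rainbow connected (resp. strongly rainbow connected) $L$-edge-colouring of $G$. *)

(* Defs.v *)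
From mathcomp Require Import all_boot.
From mathcomp Require Import classical_sets cardinality.

Set Implicit Arguments.
Unset Strict Implicit.
Unset Printing Implicit Defensive.

Record sgraph := SGraph {
  vertex :> finType;
  adj : rel vertex;
  adj_sym : symmetric adj;
  adj_irr : irreflexive adj }.

Section Graph.
Variable G : sgraph.

Definition edges : {set {set G}} :=
  [set [set p.1; p.2]%SET | p in [pred p : G * G | adj p.1 p.2]]%SET.

(* The vertex sequence x :: p is a path from x to y; its length is size p. *)
Definition path_between (x y : G) (p : seq G) : Prop :=
  [/\ path (@adj G) x p, uniq (x :: p) & last x p = y].

Definition geodesic (x y : G) (p : seq G) : Prop :=
  path_between x y p /\ forall q, path_between x y q -> size p <= size q.

(* Edge-colourings and list assignments are total on {set G}; only their
   values on [edges] are ever used. *)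
Definition rainbow (c : {set G} -> nat) (x : G) (p : seq G) : Prop :=
  uniq (pairmap (fun u v => c [set u; v]%SET) x p).

Definition rainbow_connected (c : {set G} -> nat) : Prop :=
  forall x y : G, exists p, path_between x y p /\ rainbow c x p.

Definition strongly_rainbow_connected (c : {set G} -> nat) : Prop :=
  forall x y : G, exists p, geodesic x y p /\ rainbow c x p.

Definition edge_list_assignment (r : nat) (L : {set G} -> set nat) : Prop :=
  forall e, e \in edges -> (`I_r #<= L e)%card.

Definition list_colouring (L : {set G} -> set nat) (c : {set G} -> nat) : Prop :=
  forall e, e \in edges -> L e (c e).

Definition rc_choosable (r : nat) : Prop :=
  forall L, edge_list_assignment r L ->
    exists c, list_colouring L c /\ rainbow_connected c.

Definition src_choosable (r : nat) : Prop :=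
  forall L, edge_list_assignment r L ->
    exists c, list_colouring L c /\ strongly_rainbow_connected c.

End Graph.

Definition is_minimum (P : nat -> Prop) (r : nat) : Prop :=
  P r /\ forall s, P s -> r <= s.

(* rc^l(G) = r and src^l(G) = r, as relations since a minimum is partial. *)
Definition rcl_is (G : sgraph) (r : nat) : Prop := is_minimum (@rc_choosable G) r.
Definition srcl_is (G : sgraph) (r : nat) : Prop := is_minimum (@src_choosable G) r.

(* ordS i is i + 1 modulo n; the conjunct i != j only matters for n = 1. *)
Definition cycle_adj (n : nat) : rel 'I_n :=
  fun i j => (i != j) && ((j == ordS i) || (i == ordS j)).

Lemma cycle_adj_sym n : symmetric (@cycle_adj n).
Proof. by move=> i j; rewrite /cycle_adj eq_sym orbC. Qed.

Lemma cycle_adj_irr n : irreflexive (@cycle_adj n).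
Proof. by move=> i; rewrite /cycle_adj eqxx. Qed.

Definition cycle_graph (n : nat) : sgraph :=
  SGraph (@cycle_adj_sym n) (@cycle_adj_irr n).

(* Main.v *)
(* Let k = uphalf n, and pair the edge i of the cycle with the edge i + k.
   The complete multipartite graph whose parts are these pairs (and possibly a
   singleton) is k-choosable by Erdos, Rubin and Taylor, so lists of size k
   admit a colouring in which edges of the same colour are equal or paired. Such
   edges never both lie on a path with at most n./2 edges, so all geodesics are
   rainbow. Conversely, if all lists consist of the same s < k colours, then a
   rainbow path between vertices at distance n./2 is the shorter arc; this is
   impossible for n even, and for n odd it forces all edges to get one colour. *)
Require Import Defs.
From mathcomp Require Import classical_sets cardinality functions.
From mathcomp Require Import all_boot zify.

Set Implicit Arguments.
Unset Strict Implicit.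
Unset Printing Implicit Defensive.

(** * Distinct representatives and list colouring of complete multipartite graphs *)

(** Hall's theorem, by induction on [#|S|]. If some nonempty proper [X] is tight, match [X] first
    and the rest outside its neighbourhood; otherwise any choice for one element preserves Hall's
    condition. The default [c0] serves empty [S]. *)
Lemma hall_sdr (T C : finType) (c0 : C) (S : {set T}) (A : T -> {set C}) :
  (forall X : {set T}, X \subset S -> #|X| <= #|\bigcup_(x in X) A x|) ->
  exists f : T -> C, {in S, forall x, f x \in A x} /\ {in S &, injective f}.
Proof.
have [m] := ubnP #|S|; elim: m S A => // m IHm S A leSm hallA.
have [->|[x xS]] := set_0Vmem S.
  by exists (fun=> c0); split=> [x|x y]; rewrite inE.
have [/existsP[X /and4P[sXS X0 XS tightX]] | noTight] :=
  boolP [exists X : {set T},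
    [&& X \subset S, X != set0, X != S & #|\bigcup_(x in X) A x| <= #|X|]].
  have prX : X \proper S by rewrite properEneq XS.
  have [|Y sYX|f [fA finj]] := IHm X A.
  - by have := proper_card prX; lia.
  - by apply: hallA; apply: subset_trans sXS.
  pose N := \bigcup_(x in X) A x.
  have cardSD : #|S :\: X| = #|S| - #|X| by rewrite cardsD (setIidPr sXS).
  have [||g [gA ginj]] := IHm (S :\: X) (fun x => A x :\: N).
  - by rewrite cardSD; move: X0 (subset_leq_card sXS); rewrite -card_gt0; lia.
  - move=> Y sYD.
    have dYX : [disjoint Y & X].
      by move: sYD; rewrite subsetD => /andP[].
    have sYS : Y \subset S by move: sYD; rewrite subsetD => /andP[].
    (* Hall's condition for [Y :|: X], minus the at most [#|X|] colours of [N], gives it for [Y]. *)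
    have := hallA (Y :|: X); rewrite subUset sYS sXS => /(_ isT).
    rewrite bigcup_setU -/N cardsU (disjoint_setI0 dYX) cards0 subn0.
    have -> : \bigcup_(i in Y) A i :|: N = \bigcup_(i in Y) (A i :\: N) :|: N.
      apply/setP=> c; rewrite !inE; case cN: (c \in N); rewrite ?orbT // !orbF.
      apply/bigcupP/bigcupP=> -[y yY]; last by rewrite inE => /andP[_ ?]; exists y.
      by exists y; rewrite // inE cN.
    by move: tightX; rewrite -/N cardsU; lia.
  exists (fun z => if z \in X then f z else g z); split=> [z zS | y z yS zS].
    case: ifPn => [/fA //|zX].
    by have := gA z; rewrite !inE zX zS => /(_ isT) /andP[].
  have gN u : u \in S -> u \notin X -> g u \notin N.
    by move=> uS uX; have := gA u; rewrite !inE uX uS => /(_ isT) /andP[].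
  have fN u : u \in X -> f u \in N.
    by move=> uX; apply/bigcupP; exists u => //; apply: fA.
  case: ifPn => yX; case: ifPn => zX; first exact: finj.
  - by move=> e; have := gN z zS zX; rewrite -e fN.
  - by move=> e; have := gN y yS yX; rewrite e fN.
  - by apply: ginj; rewrite inE ?yX ?zX.
have [c cA] : exists c, c \in A x.
  apply/set0Pn; rewrite -card_gt0.
  by have := hallA [set x]; rewrite big_set1 cards1 sub1set; apply.
have [||f [fA finj]] := IHm (S :\ x) (fun y => A y :\ c).
- by move: leSm; rewrite (cardsD1 x S) xS; lia.
- move=> Y; rewrite subsetD1 => /andP[sYS xY].
  have [->|Y0] := eqVneq Y set0; first by rewrite cards0.
  have YS : Y != S by apply: contraNneq xY => ->.
  have -> : \bigcup_(y in Y) (A y :\ c) = \bigcup_(y in Y) A y :\ c.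
    apply/setP=> d; rewrite !inE; apply/bigcupP/andP => [[y yY]|[dc /bigcupP[y yY dA]]].
      by rewrite !inE => /andP[-> dA]; split=> //; apply/bigcupP; exists y.
    by exists y; rewrite // !inE dc.
  (* [Y] is not tight, so it can spare the colour [c]. *)
  move/existsPn: noTight => /(_ Y); rewrite sYS Y0 YS /= -ltnNge.
  by rewrite (cardsD1 c (\bigcup_(y in Y) A y)); case: (_ \in _); lia.
exists (fun z => if z == x then c else f z); split=> [z zS | y z yS zS].
  case: eqP => [-> //|/eqP zx].
  by have := fA z; rewrite !inE zx zS => /(_ isT) /andP[].
have fc u : u \in S -> u != x -> f u != c.
  by move=> uS ux; have := fA u; rewrite !inE uS ux => /(_ isT) /andP[].
have [->|yx] := eqVneq y x; have [->|zx] := eqVneq z x => //.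
- by move=> e; have := fc z zS zx; rewrite -e eqxx.
- by move=> e; have := fc y yS yx; rewrite e eqxx.
- by apply: finj; rewrite !inE ?yx ?zx.
Qed.

(* Erdos-Rubin-Taylor: if two vertices of a part share a colour, spend it on
   that part; otherwise the two lists in each part are disjoint and Hall's
   condition holds, so all the colours can be taken distinct. *)
Lemma complete_multipartite2_choosable (T I C : finType) (c0 : C)
    (part : T -> I) (S : {set I}) (A : T -> {set C}) :
    (forall i, #|[set x | part x == i]| <= 2) ->
    (forall x, part x \in S -> #|S| <= #|A x|) ->
  exists f : T -> C, (forall x, part x \in S -> f x \in A x) /\
    forall x y, part x \in S -> part y \in S -> f x = f y -> part x = part y.
Proof.
move=> part2; have [m] := ubnP #|S|; elim: m S A => // m IHm S A leSm leSA.
have [/existsP[x /existsP[y /and4P[xy pS /eqP pxy]]]|noCommon] :=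
  boolP [exists x, exists y, [&& x != y, part x \in S, part x == part y
                                & A x :&: A y != set0]].
  move=> /set0Pn[c]; rewrite inE => /andP[cx cy].
  have cardSD : #|S| = #|S :\ part x|.+1 by rewrite (cardsD1 (part x) S) pS.
  have [||f [fA finj]] := IHm (S :\ part x) (fun z => A z :\ c).
  - by lia.
  - move=> z; rewrite !inE => /andP[_ /leSA].
    by rewrite cardSD (cardsD1 c (A z)); case: (_ \in _); lia.
  (* A part has at most two vertices, so [x] and [y] exhaust it, and both lists contain [c]. *)
  have partx z : part z = part x -> c \in A z.
    have : [set x; y] == [set z | part z == part x].
      rewrite eqEcard cards2 xy part2 andbT.
      by apply/subsetP=> u; rewrite !inE => /orP[]/eqP->; rewrite ?pxy.
    move/eqP/setP/(_ z); rewrite !inE => pz /eqP.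
    by rewrite -pz => /orP[]/eqP->.
  have fc z : part z \in S -> part z != part x -> f z \in A z /\ f z != c.
    by move=> zS zx; have := fA z; rewrite !inE zS zx => /(_ isT) /andP[].
  exists (fun z => if part z == part x then c else f z); split=> [z zS|u z uS zS].
    by case: eqP => [/partx //|/eqP zx]; have [] := fc z zS zx.
  have [->|ux] := eqVneq (part u); have [->|zx] := eqVneq (part z) => //.
  - by move=> e; have [_] := fc z zS zx; rewrite -e eqxx.
  - by move=> e; have [_] := fc u uS ux; rewrite e eqxx.
  - by apply: finj; rewrite !inE ?ux ?zx.
have [X sXV|f [fA finj]] := @hall_sdr T C c0 [set x | part x \in S] A; last first.
  exists f; split=> [x xS|x y xS yS e]; first by apply: fA; rewrite inE.
  by congr part; apply: finj; rewrite ?inE.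
have XS x : x \in X -> part x \in S.
  by move=> xX; have := subsetP sXV x xX; rewrite inE.
have [->|[x xX]] := set_0Vmem X; first by rewrite cards0.
have leA z : z \in X -> A z \subset \bigcup_(y in X) A y by apply: bigcup_sup.
have [leXS|ltSX] := leqP #|X| #|S|.
  by have := subset_leq_card (leA x xX); have := leSA x (XS x xX); lia.
have cardX : #|X| <= #|S| * 2.
  rewrite -sum1_card (partition_big part (mem S)) //= -sum_nat_const leq_sum // => i _.
  rewrite sum1_card; apply: leq_trans (part2 i); apply: subset_leq_card.
  by apply/subsetP=> z; rewrite !inE => /andP[].
(* [X] has more vertices than there are parts, so two share a part; their disjoint lists supply at
   least [2 * #|S|] colours, enough for [#|X|]. *)
have /dinjectivePn[y yX [z /andP[zy zX] pyz]] : ~~ dinjectiveb part (mem X).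
  apply/negP=> /dinjectiveP inj; move: ltSX; rewrite ltnNge -(card_in_imset inj).
  by rewrite subset_leq_card //; apply/subsetP=> _ /imsetP[u /XS ? ->].
have dAyz : A y :&: A z = set0.
  move/existsPn: noCommon => /(_ y) /existsPn/(_ z); rewrite eq_sym zy XS //= pyz eqxx.
  by move/negPn/eqP.
have sU : A y :|: A z \subset \bigcup_(y in X) A y by rewrite subUset !leA.
have := subset_leq_card sU; rewrite cardsU dAyz cards0.
have := leSA _ (XS _ yX); have := leSA _ (XS _ zX); lia.
Qed.

(** * Rotations, paths and geodesics of the cycle *)

Lemma iter_cancel (T : Type) (f g : T -> T) m :
  cancel f g -> cancel (iter m f) (iter m g).
Proof. by move=> fK; elim: m => // m IH z; rewrite iterSr iterS fK IH. Qed.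

Lemma pairmap_traject (T U : Type) (h : T -> T -> U) (f : T -> T) x m :
  pairmap h x (traject f (f x) m) = [seq h z (f z) | z <- traject f x m].
Proof. by elim: m x => //= m IH x; rewrite IH. Qed.

(** A step along [g] just after one along [f] would return to [x], so the first step fixes the
    direction of the whole path. *)
Lemma uniq_path_fpath (T : eqType) (e : rel T) (f g : T -> T) x p :
    cancel f g -> (forall y z, e y z -> (z == f y) || (z == g y)) ->
  path e (f x) p -> uniq (x :: f x :: p) -> fpath f x (f x :: p).
Proof.
move=> fK eP; elim: p x => [|z p IH] x; first by rewrite /= eqxx.
rewrite [path _ _ _]/= => /andP[/eP /orP[/eqP->|/eqP->]] pP; last first.
  by rewrite fK /= !inE eqxx !orbT.
by move=> /andP[_] /(IH _ pP) fP; rewrite /= eqxx.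
Qed.

Lemma src_choosable_rc (H : sgraph) r : src_choosable H r -> rc_choosable H r.
Proof.
move=> srcH L /srcH[c [cL crc]]; exists c; split=> // x y.
by have [p [[pP _] rp]] := crc x y; exists p.
Qed.

Section CycleGraph.
Variable n : nat.
Hypothesis n_ge3 : 3 <= n.
Implicit Types x y z : 'I_n.
Let G := cycle_graph n.

(* Both directions of rotation around the cycle satisfy this predicate, which
   makes it possible to treat clockwise and anticlockwise paths at once. *)
Definition is_rotation (f g : 'I_n -> 'I_n) : Prop :=
  [/\ cancel f g, cancel g f,
      forall x i j, (iter i f x == iter j f x) = (i == j %[mod n])
    & forall x y, @cycle_adj n x y = (y == f x) || (y == g x)].

Lemma val_iter_ordS x m : val (iter m (@ordS n) x) = (x + m) %% n.
Proof.
elim: m => [|m IH] /=; first by rewrite addn0 modn_small.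
by rewrite [nat_of_ord _]IH -addn1 modnDml addn1 addnS.
Qed.

Lemma rotation_ordS : is_rotation (@ordS n) (@ord_pred n).
Proof.
split=> [||x i j|x y]; [exact: ordSK|exact: ord_predK| |].
  by rewrite -val_eqE /= !val_iter_ordS eqn_modDl.
rewrite /cycle_adj.
have -> : (x == ordS y) = (y == ord_pred x).
  by rewrite eq_sym (can2_eq (@ordSK n) (@ord_predK n)).
have iterS m : 0 < m < n -> iter m (@ordS n) x != x.
  move=> m_n; rewrite -val_eqE /= val_iter_ordS -[X in _ != X](modn_small (ltn_ord x)).
  by rewrite -[X in _ != X %[mod _]]addn0 eqn_modDl mod0n modn_small; lia.
have [<-|//] := eqVneq x y; rewrite /= eq_sym (negPf (iterS 1 _)) /=; last lia.
apply/esym/negP=> /eqP e; have /eqP[] := iterS 1 ltac:(lia).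
by rewrite /= {1}e ord_predK.
Qed.

Lemma rotation_sym f g : is_rotation f g -> is_rotation g f.
Proof.
case=> fK gK iterf adjf; split=> // [x i j|x y]; last by rewrite adjf orbC.
(* Applying [f] [i + j] times turns [iter i g x] into [iter j f x], and [iter j g x] into
   [iter i f x]. *)
rewrite -(inj_eq (can_inj (iter_cancel (i + j) fK))) [in RHS]eq_sym -(iterf x).
by rewrite {1}[i + j]addnC !iterD !(iter_cancel _ gK).
Qed.

Lemma rotation_path f g x y p :
  is_rotation f g -> path_between (x : G) y p -> fpath f x p \/ fpath g x p.
Proof.
case=> fK gK _ adjf [pP up _]; case: p pP up => [|z p]; first by left.
move=> /= /andP[] /[1!adjf] /orP[] /eqP-> pP up; [left|right].
  by apply: (uniq_path_fpath fK _ pP up) => u v /=; rewrite adjf.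
by apply: (uniq_path_fpath gK _ pP up) => u v /=; rewrite adjf orbC.
Qed.

(** The length is congruent modulo [n] to [d] if the path follows [f], and to [n - d] if it follows
    [g]. *)
Lemma rotation_path_size f g x d p :
    is_rotation f g -> 0 < d < n -> path_between (x : G) (iter d f x) p ->
  (p = traject f (f x) (size p) /\ d <= size p) \/ n - d <= size p.
Proof.
move=> rfg dn pP; have [fK gK iterf _] := rfg; have [_ _] := pP.
have [] := rotation_path rfg pP => /fpathE pE; rewrite pE last_traject.
  move/eqP; rewrite iterf (modn_small (m := d)); last lia.
  by move/eqP=> <-; left; rewrite size_traject leq_mod.
move/(congr1 (iter (size p) f)); rewrite iter_cancel // -iterD => /eqP.
rewrite -[X in X == _]/(iter 0 f x) iterf mod0n eq_sym => /dvdn_leq.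
move=> h; right; rewrite size_traject leq_subLR addnC h //.
by lia.
Qed.

Lemma rotation_geodesic f g x d :
    is_rotation f g -> d <= n./2 ->
  geodesic (x : G) (iter d f x) (traject f (f x) d).
Proof.
move=> rfg dn; have [fK gK iterf adjf] := rfg; split; last first.
  have [->//|d0] := posnP d.
  move=> q /(rotation_path_size rfg) []; rewrite ?size_traject; [lia|by case|lia].
split; last exact: last_traject.
  apply: sub_path (fpath_traject f x d) => u v /eqP <- /=.
  by rewrite adjf eqxx.
rewrite -[x :: _]/(traject f x d.+1); apply/(uniqP x) => i j.
rewrite !inE size_traject => id jd; rewrite !nth_traject // => /eqP.
by rewrite iterf !modn_small; [move/eqP| lia| lia].
Qed.

Lemma rotation_rainbow f g (c : {set 'I_n} -> nat) x d :
    is_rotation f g ->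
    (forall z m, 0 < m < d ->
       c [set z; f z] <> c [set iter m f z; f (iter m f z)]) ->
  @rainbow G c x (traject f (f x) d).
Proof.
move=> rfg csep; rewrite /rainbow pairmap_traject.
apply/(uniqP 0) => i j; rewrite !inE size_map size_traject => id jd.
rewrite !(nth_map x) ?size_traject // !nth_traject //.
have sep i' j' : i' < j' < d ->
    c [set iter i' f x; f (iter i' f x)] <> c [set iter j' f x; f (iter j' f x)].
  move=> ij; have -> : j' = (j' - i') + i' by lia.
  by rewrite iterD; apply: csep; lia.
case: (ltngtP i j) => // ij e; last by case: (sep j i); rewrite ?ij.
by case: (sep i j); rewrite ?ij.
Qed.

(** * Edges of the cycle, and the two bounds *)

Definition cycle_edge x : {set 'I_n} := [set x; ordS x].

Lemma mem_edgesP e : reflect (exists x, e = cycle_edge x) (e \in edges G).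
Proof.
have [_ _ _ adjS] := rotation_ordS.
apply: (iffP imsetP) => [[[x y]]|[x ->]].
  rewrite inE /= adjS => /orP[]/eqP-> ->; first by exists x.
  by exists (ord_pred x); rewrite /cycle_edge ord_predK setUC.
by exists (x, ordS x) => //; rewrite inE /= adjS eqxx.
Qed.

Lemma cycle_edge_inj : injective cycle_edge.
Proof.
have [_ _ iterS _] := rotation_ordS.
move=> x y /setP exy.
have := exy x; rewrite !inE eqxx => /esym/orP[/eqP//|/eqP xy].
have := exy (ordS x); rewrite !inE eqxx orbT => /esym/orP[] /eqP; last first.
  exact: (can_inj (@ordSK n)).
rewrite xy => /eqP; rewrite -[_ == _]/(iter 2 (@ordS n) y == iter 0 (@ordS n) y).
by rewrite iterS mod0n modn_small.
Qed.

(** Without wrapping around, the two indices differ by [m], which is less than [uphalf n]; with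
    wrapping, by [n - m], strictly between [uphalf n] and twice that. *)
Lemma edge_separation (c : 'I_n -> nat) x m :
    (forall y z, c y = c z -> y = z %[mod uphalf n]) -> 0 < m < n./2 ->
  c x <> c (iter m (@ordS n) x).
Proof.
move=> cP mn /cP /eqP; rewrite val_iter_ordS.
have xn := ltn_ord x.
have [lt_n|ge_n] := ltnP (x + m) n.
  rewrite (modn_small lt_n) -{1}[nat_of_ord x]addn0 eqn_modDl mod0n modn_small; lia.
have -> : (x + m) %% n = x + m - n.
  by rewrite -{1}(subnK ge_n) modnDr modn_small; lia.
have {1}-> : (x : nat) = (x + m - n) + (n - m - uphalf n) + uphalf n by lia.
rewrite modnDr -{2}[x + m - n]addn0 eqn_modDl mod0n modn_small; lia.
Qed.

Lemma cycle_src_choosable : src_choosable G (uphalf n).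
Proof.
set k := uphalf n => L Lk.
have k0 : 0 < k by rewrite /k; lia.
have /fin_all_exists[phi phiP] x : exists phi : 'I_k -> nat,
    injective phi /\ forall i, L (cycle_edge x) (phi i).
  have /Lk/pcard_leP[psi] : cycle_edge x \in edges G by apply/mem_edgesP; exists x.
  exists (fun i : 'I_k => psi i); split=> [i j /inj ij|i].
    by apply/val_inj/ij; apply/mem_set/ltn_ord.
  by apply: (@funS _ _ _ _ psi); exact: ltn_ord.
(* Bounding the chosen colours by [N] puts all lists into the finite type ['I_N.+1]. *)
pose N := \max_x \max_i phi x i.
have phiN x i : phi x i < N.+1.
  by rewrite ltnS (leq_trans _ (leq_bigmax x)) // (leq_bigmax i).
pose part x : 'I_k := Ordinal (ltn_pmod x k0).
have [||f [fA fpart]] := @complete_multipartite2_choosable 'I_n 'I_k 'I_N.+1 ord0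
    part setT (fun x => [set inord (phi x i) | i in setT]).
- move=> i; pose x0 : 'I_n := Ordinal (ltn_trans (ltn0Sn 1) n_ge3).
  (* A residue class modulo [k] lies in [{i, i + k}]; if [i + k = n], for odd [n], [insubd] falls
     back to [x0]. *)
  have : [set x | part x == i] \subset
      [set insubd x0 (val i); insubd x0 (i + k)].
    apply/subsetP=> x; rewrite !inE -!val_eqE /= !val_insubd => /eqP <-.
    have := divn_eq x k; have := ltn_pmod x k0; have := ltn_ord x.
    have : x %/ k < 2 by rewrite ltn_divLR // /k; have := ltn_ord x; lia.
    case: (x %/ k) => [|[|//]] _; case: ifP; case: ifP; rewrite /k; lia.
  by move/subset_leq_card/leq_trans; apply; rewrite cards2; case: (_ == _).
- move=> x _; rewrite card_in_imset ?cardsT // => i j _ _ /(congr1 val) /=.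
  by rewrite !inordK // => /(proj1 (phiP x)).
pose c (e : {set 'I_n}) : nat :=
  if [pick x | e == cycle_edge x] is Some x then f x else 0.
have cE x : c (cycle_edge x) = f x.
  rewrite /c; case: pickP => [y /eqP/cycle_edge_inj-> //|/(_ x)].
  by rewrite eqxx.
exists c; split.
  move=> _ /mem_edgesP[x ->]; rewrite cE.
  by have /imsetP[i _ ->] := fA x (in_setT _); rewrite inordK //; case: (phiP x).
have csepS z m : 0 < m < n./2 ->
    c (cycle_edge z) <> c (cycle_edge (iter m (@ordS n) z)).
  apply: (edge_separation (c := fun z => c (cycle_edge z))) => u v.
  by rewrite !cE => /val_inj/fpart => /(_ (in_setT _) (in_setT _)) /(congr1 val).
(* The anticlockwise case is the clockwise one read from the far edge. *)
have csepP z m : 0 < m < n./2 -> c [set z; ord_pred z] <>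
    c [set iter m (@ord_pred n) z; ord_pred (iter m (@ord_pred n) z)].
  move=> mn; have edgeP u : [set u; ord_pred u] = cycle_edge (ord_pred u).
    by rewrite /cycle_edge ord_predK setUC.
  rewrite !edgeP -iterS iterSr => /esym e.
  case: (csepS (iter m (@ord_pred n) (ord_pred z)) m mn).
  by rewrite (iter_cancel _ (@ord_predK n)).
move=> x y; pose d := (n - x + y) %% n.
have dE : iter d (@ordS n) x = y.
  apply/val_inj; rewrite val_iter_ordS modnDmr addnA subnKC; last exact: ltnW.
  by rewrite addnC modnDr modn_small.
have rS := rotation_ordS; have rP := rotation_sym rS.
have [le_d|gt_d] := leqP d n./2.
  exists (traject (@ordS n) (ordS x) d); split.
    by rewrite -{1}dE; apply: rotation_geodesic rS _.
  by apply: rotation_rainbow rS _ => z m mn; apply: csepS; lia.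
(* The clockwise arc is too long; the other one has [n - d <= n./2] edges. *)
have dn : d < n by rewrite ltn_pmod; lia.
have dE' : iter (n - d) (@ord_pred n) x = y.
  have [_ _ iterS _] := rS.
  apply: (can_inj (iter_cancel (n - d) (@ordSK n))).
  rewrite (iter_cancel _ (@ord_predK n)) -dE -iterD subnK; last exact: ltnW.
  by apply/eqP; rewrite -[X in X == _]/(iter 0 (@ordS n) x) iterS modnn mod0n.
exists (traject (@ord_pred n) (ord_pred x) (n - d)); split.
  by rewrite -{1}dE'; apply: rotation_geodesic rP _; lia.
by apply: rotation_rainbow rP _ => z m mn; apply: csepP; lia.
Qed.

(* If fewer than uphalf n colours occur, then n is odd and every path with
   k = n./2 edges is rainbow and uses all the colours. Comparing consecutive
   such paths, the edges x and x + k have the same colour; as 2k + 1 = n, so do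
   adjacent edges. *)
Lemma cycle_rc_choosable_ge s : 4 <= n -> rc_choosable G s -> uphalf n <= s.
Proof.
move=> n4 rcs; rewrite leqNgt; apply/negP=> s_lt.
have [//|c [cs crc]] := rcs (fun=> `I_s)%classic.
set k := n./2; have rS := rotation_ordS; have [_ _ iterS _] := rS.
pose C x := c (cycle_edge x).
have C_s x : C x \in iota 0 s.
  by rewrite mem_iota; apply: cs; apply/mem_edgesP; exists x.
have window x : uniq [seq C z | z <- traject (@ordS n) x k] /\ s = k.
  have [p [pP]] := crc x (iter k (@ordS n) x); rewrite /rainbow.
  have kn : 0 < k < n by rewrite /k; lia.
  have /(uniq_leq_size (s2 := iota 0 s)) small :
      {subset pairmap (fun u v => c [set u; v]) x p <= iota 0 s}.
    have [pP' _ _] := pP; elim: (p : seq 'I_n) x pP' {pP} => //= y q IH x /andP[xy qP] z.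
    rewrite inE => /orP[/eqP->|/IH]; last exact.
    by rewrite mem_iota; apply: cs; apply/imsetP; exists (x, y).
  move=> up; move: (small up); rewrite size_pairmap size_iota => p_s.
  (* The other way round takes at least [n - k = uphalf n] edges, more than the [s] colours of a
     rainbow path. *)
  have [[pE le_k]|] := rotation_path_size rS kn pP; last first.
    by move: s_lt p_s kn; rewrite /k; lia.
  have [p_k s_k] : size p = k /\ s = k by move: s_lt p_s le_k; rewrite /k; lia.
  by split=> //; move: up; rewrite pE p_k pairmap_traject.
have x0 : 'I_n := Ordinal (ltn_trans (ltn0Sn 2) n4).
have s_k : s = k by case: (window x0).
(* The windows at [x] and [ordS x] share all but one edge each; the first shows all [s] colours, so
   the new edge must repeat the colour of the dropped one. *)
have shift x : C (iter k (@ordS n) x) = C x.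
  have [ux _] := window x; have [uSx _] := window (ordS x).
  have k1 : k = k.-1.+1 by rewrite /k; lia.
  have : C (iter k (@ordS n) x) \in [seq C z | z <- traject (@ordS n) x k].
    have sub : {subset [seq C z | z <- traject (@ordS n) x k] <= iota 0 s}.
      by move=> _ /mapP[z _ ->].
    have [|_ ->] := uniq_min_size ux sub; last exact: C_s.
    by rewrite size_map size_traject size_iota s_k.
  move: uSx; rewrite k1 trajectSr map_rcons rcons_uniq -iterSr => /andP[notin _].
  by rewrite [traject _ x _]/= inE (negPf notin) orbF => /eqP.
have n2k : n = k + k.+1 by move: s_lt; rewrite s_k /k; lia.
have CS : C (ordS x0) = C x0.
  (* From [ordS x0], two shifts by [k] make [2 * k + 1 = n] steps from [x0], a full turn. *)
  have {2}-> : x0 = iter k (@ordS n) (iter k (@ordS n) (ordS x0)).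
    apply/eqP; rewrite -iterD -iterSr -[X in X == _]/(iter 0 (@ordS n) x0) iterS.
    by rewrite -addnS -n2k modnn mod0n.
  by rewrite !shift.
(* Here [n >= 4] gives [k >= 2], so a single window contains both equally coloured edges. *)
have [] := window x0; have -> : k = k.-2.+2 by rewrite /k; lia.
by rewrite /= inE CS eqxx.
Qed.
End CycleGraph.

(* uphalf n is the ceiling of n / 2. *)
Theorem theorem3p5 (n : nat) (hn : 4 <= n) :
  rcl_is (cycle_graph n) (uphalf n) /\ srcl_is (cycle_graph n) (uphalf n).
Proof.
(* The upper bound passes from [src] to [rc], the lower bound from [rc] to [src]. *)
have srcn := cycle_src_choosable (ltnW hn).
split; split=> //.
- exact: src_choosable_rc.
- by move=> s; apply: cycle_rc_choosable_ge => //; apply: ltnW.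
- by move=> s /src_choosable_rc; apply: cycle_rc_choosable_ge => //; apply: ltnW.
Qed.
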